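(* Let $\Bbbk$ be a field of characteristic zero, $U=\langle x,y,z\rangle$ a three-dimensional $\Bbbk$-vector space, $R=\operatorname{Sym}(U)$, and $$I=(x^{a+1},y^{b+1},z^{c+1})\subset R,\qquad a,b,c\ge1.$$ Put $s=x^ay^bz^c$, $d=a+b+c$ and $\mathfrak g_I=M(U)/IB(U)$. Then $$\bigl(B(U)/IB(U)\bigr)_d=0,\qquad(\mathfrak g_I')_{d+2}=0,\qquad s\,\mathfrak g_I'=0,$$ and consequently $$IB(U)=(I+(s))B(U).$$ The two distinct ideals $I$ and $I+(s)$ therefore define the same metabelian Lie quotient.
   Context: $M(U)=\operatorname{Lie}(U)/\operatorname{Lie}(U)''$ is the free metabelian Lie algebra on $U$, and $B(U)=M(U)'$ is its derived algebra, an abelian ideal that is a graded $R$-module via $u\cdot b=[u,b]$. Commutators $[u,v]$ ($u,v\in U$) have internal degree $0$, so internal degree $r$ corresponds to Lie degree $r+2$: $(B(U)/IB(U))_d$ uses internal degree and $(\mathfrak g_I')_{d+2}$ uses Lie degree. For a homogeneous ideal $J\subset R$, the associated metabelian Lie quotient is $M(U)/JB(U)$, whose derived algebra is $B(U)/JB(U)$. *)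

(* Defs.v *)
From HB Require Import structures.
From mathcomp Require Import all_boot all_order all_algebra.
From mathcomp Require Import boolp classical_sets.
From mathcomp Require Import mpoly.

Set Implicit Arguments.
Unset Strict Implicit.
Unset Printing Implicit Defensive.

Import GRing.Theory.
Local Open Scope ring_scope.
Local Open Scope classical_set_scope.
Local Open Scope quotient_scope.

Record submod (R : nzRingType) (V : lmodType R) := Submod {
  submod_set :> V -> Prop;
  submod0 : submod_set 0;
  submodD : forall u v, submod_set u -> submod_set v -> submod_set (u + v);
  submodZ : forall a v, submod_set v -> submod_set (a *: v) }.

Section SubmodTheory.
Variables (R : nzRingType) (V : lmodType R).
Implicit Types N P : submod V.

Lemma submodN N v : N v -> N (- v).
Proof. by move=> Nv; rewrite -scaleN1r; apply: submodZ. Qed.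

Lemma submodB N u v : N u -> N v -> N (u - v).
Proof. by move=> Nu Nv; apply: submodD => //; apply: submodN. Qed.

Lemma submod_eqP N P : (N : set V) = P -> N = P.
Proof.
case: N P => [N n0 nD nZ] [P p0 pD pZ] /= eNP.
by move: n0 nD nZ; rewrite eNP => n0 nD nZ; congr Submod; apply: Prop_irrelevance.
Qed.

Inductive span_set (S : set V) : set V :=
  | span_gen v : S v -> span_set S v
  | span_0 : span_set S 0
  | span_D u v : span_set S u -> span_set S v -> span_set S (u + v)
  | span_Z a v : span_set S v -> span_set S (a *: v).

Definition span (S : set V) : submod V :=
  Submod (span_0 S) (@span_D S) (@span_Z S).

Lemma span_min S N : S `<=` N -> span S `<=` N.
Proof.
move=> sSN v; elim=> {v} [v /sSN//||u v _ Nu _ Nv|a v _ Nv].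
- exact: submod0.
- exact: submodD.
- exact: submodZ.
Qed.

Definition addsm N P : submod V := span (N `|` P).

Definition quotmod_rel N : rel V := fun u v => `[< N (u - v) >].

Lemma quotmod_equiv N : equiv_class_of (quotmod_rel N).
Proof.
split=> [u | u v | v u w].
- by apply/asboolP; rewrite subrr; apply: submod0.
- by apply: asbool_equiv_eq; split=> /submodN; rewrite opprB.
- move=> /asboolP Nuv /asboolP Nvw; apply/asboolP.
  by rewrite -[u](subrK v) -addrA; apply: submodD.
Qed.

Canonical quotmod_equiv_rel N := EquivRelPack (quotmod_equiv N).

Definition quotmod N := {eq_quot (quotmod_rel N)}.

HB.instance Definition _ N := Choice.on (quotmod N).
HB.instance Definition _ N := EqQuotient.on (quotmod N).

Definition qproj N (v : V) : quotmod N := \pi_(quotmod N) v.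

Lemma qproj_eq N u v : qproj N u = qproj N v <-> N (u - v).
Proof.
split=> [/eqmodP/asboolP // | Nuv]; first by apply/eqmodP/asboolP.
Qed.

Lemma qprojK N (q : quotmod N) : qproj N (repr q) = q.
Proof. exact: reprK. Qed.

Lemma qproj_surj N (q : quotmod N) : exists v, qproj N v = q.
Proof. by exists (repr q); apply: qprojK. Qed.

Lemma repr_qproj N v : N (repr (qproj N v) - v).
Proof. by apply/qproj_eq; rewrite qprojK. Qed.

Definition qadd N (p q : quotmod N) := qproj N (repr p + repr q).
Definition qopp N (q : quotmod N) := qproj N (- repr q).
Definition qscale N a (q : quotmod N) := qproj N (a *: repr q).

Lemma qaddE N u v : qadd (qproj N u) (qproj N v) = qproj N (u + v).
Proof. by apply/qproj_eq; rewrite opprD addrACA; apply: submodD; apply: repr_qproj. Qed.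

Lemma qoppE N u : qopp (qproj N u) = qproj N (- u).
Proof. by apply/qproj_eq; rewrite -opprD; apply/submodN/repr_qproj. Qed.

Lemma qscaleE N a u : qscale a (qproj N u) = qproj N (a *: u).
Proof. by apply/qproj_eq; rewrite -scalerBr; apply/submodZ/repr_qproj. Qed.

Fact qaddA N : associative (@qadd N).
Proof.
move=> p q r; rewrite -[p]qprojK -[q]qprojK -[r]qprojK.
by rewrite !qaddE addrA.
Qed.
Fact qaddC N : commutative (@qadd N).
Proof. by move=> p q; rewrite -[p]qprojK -[q]qprojK !qaddE addrC. Qed.
Fact qadd0 N : left_id (qproj N 0) (@qadd N).
Proof. by move=> p; rewrite -[p]qprojK qaddE add0r. Qed.
Fact qaddN N : left_inverse (qproj N 0) (@qopp N) (@qadd N).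
Proof. by move=> p; rewrite -[p]qprojK qoppE qaddE addNr. Qed.

HB.instance Definition _ N :=
  GRing.isZmodule.Build (quotmod N) (@qaddA N) (@qaddC N) (@qadd0 N) (@qaddN N).

Let qprojD N u v : qproj N u + qproj N v = qproj N (u + v).
Proof. exact: qaddE. Qed.

Fact qscaleA N a b (q : quotmod N) : qscale a (qscale b q) = qscale (a * b) q.
Proof. by rewrite -[q]qprojK !qscaleE scalerA. Qed.
Fact qscale1 N : left_id 1 (@qscale N).
Proof. by move=> q; rewrite -[q]qprojK qscaleE scale1r. Qed.
Fact qscaleDr N : right_distributive (@qscale N) +%R.
Proof.
move=> a p q; rewrite -[p]qprojK -[q]qprojK.
by rewrite !(qprojD, qscaleE) scalerDr.
Qed.
Fact qscaleDl N (q : quotmod N) : {morph (@qscale N)^~ q : a b / a + b}.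
Proof. by move=> a b; rewrite -[q]qprojK !qscaleE qprojD scalerDl. Qed.

HB.instance Definition _ N := GRing.Zmodule_isLmodule.Build R (quotmod N)
  (@qscaleA N) (@qscale1 N) (@qscaleDr N) (@qscaleDl N).

Fact qproj_linear N : linear (qproj N).
Proof. by move=> a u v; rewrite -qprojD -qscaleE. Qed.
HB.instance Definition _ N := GRing.isLinear.Build R V (quotmod N) _
  (qproj N) (@qproj_linear N).

Lemma qproj_eq0 N v : qproj N v = 0 <-> N v.
Proof. by rewrite -(linear0 (qproj N)) qproj_eq subr0. Qed.

End SubmodTheory.

Arguments span {R V} S.
Arguments qproj {R V} N v.

Section Ideals.
Variable R : comNzRingType.

(* Not the library's idealr, which is decidable and proper. *)
Definition ideal := submod R^o.

Definition genideal (S : set R) : ideal := span (S : set R^o).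

Definition ideal_mul (I : ideal) (V : lmodType R) : submod V :=
  span [set v | exists2 p, I p & exists w, v = p *: w].

End Ideals.

HB.mixin Record isLieAlgebra (K : fieldType) L of GRing.Lmodule K L := {
  lie : L -> L -> L;
  lieDl : forall u v w, lie (u + v) w = lie u w + lie v w;
  lieZl : forall a u v, lie (a *: u) v = a *: lie u v;
  lieDr : forall u v w, lie u (v + w) = lie u v + lie u w;
  lieZr : forall a u v, lie u (a *: v) = a *: lie u v;
  liexx : forall u, lie u u = 0;
  jacobi : forall u v w,
    lie u (lie v w) + lie v (lie w u) + lie w (lie u v) = 0 }.

#[short(type="lieAlgType")]
HB.structure Definition LieAlgebra (K : fieldType) :=
  { L of isLieAlgebra K L & GRing.Lmodule K L }.

Definition lie_morphism (K : fieldType) (L1 L2 : lieAlgType K)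
    (f : {linear L1 -> L2}) : Prop :=
  forall u v, f (lie u v) = lie (f u) (f v).

Record lieIdeal (K : fieldType) (L : lieAlgType K) := LieIdeal {
  ideal_submod :> submod L;
  ideal_lie : forall u v, ideal_submod v -> ideal_submod (lie u v) }.

Section LieTheory.
Variables (K : fieldType) (L : lieAlgType K).
Implicit Types (u v w : L) (J : lieIdeal L).

Lemma lieC u v : lie u v = - lie v u.
Proof.
apply/eqP; rewrite -addr_eq0; apply/eqP.
by have := liexx (u + v); rewrite lieDl !lieDr !liexx add0r addr0.
Qed.

Lemma lie0 u : lie u 0 = 0.
Proof. by have := lieZr 0 u 0; rewrite !scale0r. Qed.

Lemma lie0r u : lie 0 u = 0.
Proof. by rewrite lieC lie0 oppr0. Qed.

Lemma lieNr u v : lie u (- v) = - lie u v.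
Proof. by rewrite -scaleN1r lieZr scaleN1r. Qed.

Lemma lieNl u v : lie (- u) v = - lie u v.
Proof. by rewrite -scaleN1r lieZl scaleN1r. Qed.

Lemma lie_suml I (r : seq I) (F : I -> L) u :
  lie (\sum_(i <- r) F i) u = \sum_(i <- r) lie (F i) u.
Proof.
elim: r => [|i r IH]; first by rewrite !big_nil lie0r.
by rewrite !big_cons lieDl IH.
Qed.

Lemma jacobi_ad u v w : lie u (lie v w) = lie (lie u v) w + lie v (lie u w).
Proof.
have /eqP := jacobi u v w; rewrite -addrA addr_eq0 => /eqP ->.
by rewrite opprD addrC -lieC (lieC w u) lieNr opprK.
Qed.

Lemma ideal_lier J u v : J u -> J (lie u v).
Proof. by move=> Ju; rewrite lieC; apply/submodN/ideal_lie. Qed.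

Definition full_submod : submod L :=
  @Submod _ _ (@setT L) I (fun _ _ _ _ => I) (fun _ _ _ => I).
Definition full_ideal : lieIdeal L :=
  @LieIdeal _ _ full_submod (fun _ _ _ => I).

Definition brset (A B : set L) : set L :=
  [set w | exists u v, [/\ A u, B v & w = lie u v]].

Fact br_ideal_proof (A B : lieIdeal L) u v :
  span (brset A B) v -> span (brset A B) (lie u v).
Proof.
elim=> {v} [_ [v [w [Av Bw ->]]] || v w _ IHv _ IHw | a v _ IHv].
- rewrite jacobi_ad; apply: submodD; apply: span_gen.
  + by exists (lie u v), w; split=> //; apply: ideal_lie.
  + by exists v, (lie u w); split=> //; apply: ideal_lie.
- by rewrite lie0; apply: submod0.
- by rewrite lieDr; apply: submodD.
- by rewrite lieZr; apply: submodZ.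
Qed.

Definition br_ideal (A B : lieIdeal L) : lieIdeal L :=
  LieIdeal (@br_ideal_proof A B).

Definition derived : lieIdeal L := br_ideal full_ideal full_ideal.
Definition derived2 : lieIdeal L := br_ideal derived derived.

Lemma derived_lie u v : derived (lie u v).
Proof. by apply: span_gen; exists u, v. Qed.

(* derived2 L is L'', so this says L'' = 0. *)
Definition metabelian := derived2 `<=` [set 0].

End LieTheory.

Arguments derived {K} L.
Arguments derived2 {K} L.
Arguments metabelian {K} L.

Section LieQuotient.
Variables (K : fieldType) (L : lieAlgType K) (J : lieIdeal L).

Definition quotlie : Type := quotmod J.
HB.instance Definition _ := GRing.Lmodule.on quotlie.

Definition lproj (u : L) : quotlie := qproj J u.
HB.instance Definition _ := GRing.isLinear.Build K L quotlie _
  lproj (qproj_linear J).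

Lemma lproj_surj (q : quotlie) : exists u, lproj u = q.
Proof. exact: qproj_surj. Qed.

Lemma lproj_eq u v : lproj u = lproj v <-> J (u - v).
Proof. exact: qproj_eq. Qed.

Lemma lproj_eq0 u : lproj u = 0 <-> J u.
Proof. exact: qproj_eq0. Qed.

Definition qlie (p q : quotlie) : quotlie :=
  lproj (lie (repr (p : quotmod J)) (repr (q : quotmod J))).

Lemma qlieE u v : qlie (lproj u) (lproj v) = lproj (lie u v).
Proof.
apply/lproj_eq; set u' := repr _; set v' := repr _.
have -> : lie u' v' - lie u v = lie (u' - u) v' + lie u (v' - v).
  by rewrite lieDl lieDr lieNl lieNr addrA subrK.
apply: submodD; first exact/ideal_lier/repr_qproj.
exact/ideal_lie/repr_qproj.
Qed.

Local Ltac qlift q := let u := fresh "u" in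
  have [u <-] := lproj_surj q; move=> {q}; rename u into q.

Fact qlieDl p q r : qlie (p + q) r = qlie p r + qlie q r.
Proof. by qlift p; qlift q; qlift r; rewrite -linearD !qlieE lieDl linearD. Qed.
Fact qlieDr p q r : qlie p (q + r) = qlie p q + qlie p r.
Proof. by qlift p; qlift q; qlift r; rewrite -linearD !qlieE lieDr linearD. Qed.
Fact qlieZl a p q : qlie (a *: p) q = a *: qlie p q.
Proof. by qlift p; qlift q; rewrite -linearZ !qlieE lieZl linearZ. Qed.
Fact qlieZr a p q : qlie p (a *: q) = a *: qlie p q.
Proof. by qlift p; qlift q; rewrite -linearZ !qlieE lieZr linearZ. Qed.
Fact qliexx p : qlie p p = 0.
Proof. by qlift p; rewrite qlieE liexx linear0. Qed.
Fact qjacobi p q r :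
  qlie p (qlie q r) + qlie q (qlie r p) + qlie r (qlie p q) = 0.
Proof.
by qlift p; qlift q; qlift r; rewrite !qlieE -(linear0 lproj) -(jacobi p q r) !linearD.
Qed.

HB.instance Definition _ := isLieAlgebra.Build K quotlie
  qlieDl qlieZl qlieDr qlieZr qliexx qjacobi.

Lemma lproj_lie : lie_morphism lproj.
Proof. by move=> u v; apply: esym (qlieE u v). Qed.

End LieQuotient.

Arguments lproj {K L} J u.

Section FreeLie.
Variables (K : fieldType) (U : lmodType K).

Inductive lterm : Type :=
  | TGen of U
  | TZero
  | TAdd of lterm & lterm
  | TOpp of lterm
  | TScale of K & lterm
  | TLie of lterm & lterm.

(* The congruence imposing the axioms of Lie algebras and the linearity of
   the inclusion of U. *)
Inductive lcong : lterm -> lterm -> Prop :=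
  | lc_refl s : lcong s s
  | lc_sym s t : lcong s t -> lcong t s
  | lc_trans s t r : lcong s t -> lcong t r -> lcong s r
  | lc_add s s' t t' : lcong s s' -> lcong t t' -> lcong (TAdd s t) (TAdd s' t')
  | lc_opp s s' : lcong s s' -> lcong (TOpp s) (TOpp s')
  | lc_scale a s s' : lcong s s' -> lcong (TScale a s) (TScale a s')
  | lc_lie s s' t t' : lcong s s' -> lcong t t' -> lcong (TLie s t) (TLie s' t')
  | lc_addA s t r : lcong (TAdd s (TAdd t r)) (TAdd (TAdd s t) r)
  | lc_addC s t : lcong (TAdd s t) (TAdd t s)
  | lc_add0 s : lcong (TAdd TZero s) s
  | lc_addN s : lcong (TAdd (TOpp s) s) TZero
  | lc_scaleA a b s : lcong (TScale a (TScale b s)) (TScale (a * b) s)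
  | lc_scale1 s : lcong (TScale 1 s) s
  | lc_scaleDr a s t :
      lcong (TScale a (TAdd s t)) (TAdd (TScale a s) (TScale a t))
  | lc_scaleDl a b s :
      lcong (TScale (a + b) s) (TAdd (TScale a s) (TScale b s))
  | lc_lieDl s t r : lcong (TLie (TAdd s t) r) (TAdd (TLie s r) (TLie t r))
  | lc_lieZl a s t : lcong (TLie (TScale a s) t) (TScale a (TLie s t))
  | lc_lieDr s t r : lcong (TLie s (TAdd t r)) (TAdd (TLie s t) (TLie s r))
  | lc_lieZr a s t : lcong (TLie s (TScale a t)) (TScale a (TLie s t))
  | lc_liexx s : lcong (TLie s s) TZero
  | lc_jacobi s t r :
      lcong (TAdd (TAdd (TLie s (TLie t r)) (TLie t (TLie r s)))
                  (TLie r (TLie s t))) TZero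
  | lc_genD u v : lcong (TGen (u + v)) (TAdd (TGen u) (TGen v))
  | lc_genZ a u : lcong (TGen (a *: u)) (TScale a (TGen u)).

HB.instance Definition _ := gen_eqMixin lterm.
HB.instance Definition _ := gen_choiceMixin lterm.

Definition lcongb : rel lterm := fun s t => `[< lcong s t >].

Lemma lcongb_equiv : equiv_class_of lcongb.
Proof.
split=> [s | s t | t s r].
- by apply/asboolP; apply: lc_refl.
- by apply: asbool_equiv_eq; split; apply: lc_sym.
- by move=> /asboolP st /asboolP tr; apply/asboolP; apply: lc_trans tr.
Qed.

Canonical lcongb_equiv_rel := EquivRelPack lcongb_equiv.

Definition freeLie := {eq_quot lcongb}.

HB.instance Definition _ := Choice.on freeLie.
HB.instance Definition _ := EqQuotient.on freeLie.

Definition fclass (s : lterm) : freeLie := \pi_freeLie s.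

Lemma fclass_eq s t : fclass s = fclass t <-> lcong s t.
Proof. by split=> [/eqmodP/asboolP // | st]; apply/eqmodP/asboolP. Qed.

Lemma fclassK (f : freeLie) : fclass (repr f) = f.
Proof. exact: reprK. Qed.

Lemma repr_fclass s : lcong (repr (fclass s)) s.
Proof. by apply/fclass_eq; rewrite fclassK. Qed.

Definition fadd (f g : freeLie) := fclass (TAdd (repr f) (repr g)).
Definition fopp (f : freeLie) := fclass (TOpp (repr f)).
Definition fscale a (f : freeLie) := fclass (TScale a (repr f)).
Definition flie (f g : freeLie) := fclass (TLie (repr f) (repr g)).

Lemma faddE s t : fadd (fclass s) (fclass t) = fclass (TAdd s t).
Proof. by apply/fclass_eq; apply: lc_add; apply: repr_fclass. Qed.
Lemma foppE s : fopp (fclass s) = fclass (TOpp s).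
Proof. by apply/fclass_eq; apply: lc_opp; apply: repr_fclass. Qed.
Lemma fscaleE a s : fscale a (fclass s) = fclass (TScale a s).
Proof. by apply/fclass_eq; apply: lc_scale; apply: repr_fclass. Qed.
Lemma flieE s t : flie (fclass s) (fclass t) = fclass (TLie s t).
Proof. by apply/fclass_eq; apply: lc_lie; apply: repr_fclass. Qed.

Let fE := (faddE, foppE, fscaleE, flieE).

Fact faddA : associative fadd.
Proof.
move=> f g h; rewrite -[f]fclassK -[g]fclassK -[h]fclassK !fE.
by apply/fclass_eq; constructor.
Qed.
Fact faddC : commutative fadd.
Proof.
move=> f g; rewrite -[f]fclassK -[g]fclassK !fE.
by apply/fclass_eq; apply: lc_addC.
Qed.
Fact fadd0 : left_id (fclass TZero) fadd.
Proof. by move=> f; rewrite -[f]fclassK !fE; apply/fclass_eq; apply: lc_add0. Qed.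
Fact faddN : left_inverse (fclass TZero) fopp fadd.
Proof. by move=> f; rewrite -[f]fclassK !fE; apply/fclass_eq; apply: lc_addN. Qed.

HB.instance Definition _ :=
  GRing.isZmodule.Build freeLie faddA faddC fadd0 faddN.

Let fDE s t : fclass s + fclass t = fclass (TAdd s t).
Proof. exact: faddE. Qed.

Fact fscaleA a b f : fscale a (fscale b f) = fscale (a * b) f.
Proof. by rewrite -[f]fclassK !fE; apply/fclass_eq; apply: lc_scaleA. Qed.
Fact fscale1 : left_id 1 fscale.
Proof. by move=> f; rewrite -[f]fclassK !fE; apply/fclass_eq; apply: lc_scale1. Qed.
Fact fscaleDr : right_distributive fscale +%R.
Proof.
move=> a f g; rewrite -[f]fclassK -[g]fclassK !(fE, fDE).
by apply/fclass_eq; apply: lc_scaleDr.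
Qed.
Fact fscaleDl f : {morph fscale^~ f : a b / a + b}.
Proof.
move=> a b; rewrite -[f]fclassK !(fE, fDE).
by apply/fclass_eq; apply: lc_scaleDl.
Qed.

HB.instance Definition _ := GRing.Zmodule_isLmodule.Build K freeLie
  fscaleA fscale1 fscaleDr fscaleDl.

Let fZE a s : a *: fclass s = fclass (TScale a s).
Proof. exact: fscaleE. Qed.

Fact flieDl f g h : flie (f + g) h = flie f h + flie g h.
Proof.
rewrite -[f]fclassK -[g]fclassK -[h]fclassK !(fE, fDE).
by apply/fclass_eq; apply: lc_lieDl.
Qed.
Fact flieDr f g h : flie f (g + h) = flie f g + flie f h.
Proof.
rewrite -[f]fclassK -[g]fclassK -[h]fclassK !(fE, fDE).
by apply/fclass_eq; apply: lc_lieDr.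
Qed.
Fact flieZl a f g : flie (a *: f) g = a *: flie f g.
Proof.
rewrite -[f]fclassK -[g]fclassK !(fE, fZE).
by apply/fclass_eq; apply: lc_lieZl.
Qed.
Fact flieZr a f g : flie f (a *: g) = a *: flie f g.
Proof.
rewrite -[f]fclassK -[g]fclassK !(fE, fZE).
by apply/fclass_eq; apply: lc_lieZr.
Qed.
Fact fliexx f : flie f f = 0.
Proof. by rewrite -[f]fclassK fE; apply/fclass_eq; apply: lc_liexx. Qed.
Fact fjacobi f g h :
  flie f (flie g h) + flie g (flie h f) + flie h (flie f g) = 0.
Proof.
rewrite -[f]fclassK -[g]fclassK -[h]fclassK !(fE, fDE).
by apply/fclass_eq; apply: lc_jacobi.
Qed.

HB.instance Definition _ := isLieAlgebra.Build K freeLie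
  flieDl flieZl flieDr flieZr fliexx fjacobi.

Let fLE s t : lie (fclass s) (fclass t) = fclass (TLie s t).
Proof. exact: flieE. Qed.

Definition fgen (u : U) : freeLie := fclass (TGen u).

Fact fgen_linear : linear fgen.
Proof.
move=> a u v; rewrite /fgen fZE fDE; apply/fclass_eq.
by apply: (lc_trans (lc_genD _ _)); apply: lc_add; [apply: lc_genZ | apply: lc_refl].
Qed.
HB.instance Definition _ := GRing.isLinear.Build K U freeLie _ fgen fgen_linear.

Lemma freeLie_ind (P : freeLie -> Prop) :
  (forall u, P (fgen u)) -> P 0 -> (forall f g, P f -> P g -> P (f + g)) ->
  (forall a f, P f -> P (a *: f)) -> (forall f g, P f -> P g -> P (lie f g)) ->
  forall f, P f.
Proof.
move=> Pg P0 PD PZ PL f; rewrite -[f]fclassK; elim: (repr f) => {f}.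
- exact: Pg.
- exact: P0.
- by move=> s Ps t Pt; rewrite -fDE; apply: PD.
- move=> s Ps; suff -> : fclass (TOpp s) = -1 *: fclass s by apply: PZ.
  by rewrite scaleN1r -foppE.
- by move=> a s Ps; rewrite -fZE; apply: PZ.
- by move=> s Ps t Pt; rewrite -flieE; apply: PL.
Qed.

Section Universal.
Variables (L : lieAlgType K) (j : {linear U -> L}).

Fixpoint teval (s : lterm) : L :=
  match s with
  | TGen u => j u
  | TZero => 0
  | TAdd s t => teval s + teval t
  | TOpp s => - teval s
  | TScale a s => a *: teval s
  | TLie s t => lie (teval s) (teval t)
  end.

Lemma teval_cong s t : lcong s t -> teval s = teval t.
Proof.
elim=> //= {s t}.
- by move=> s t r _ -> _ ->.
- by move=> s s' t t' _ -> _ ->.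
- by move=> s s' _ ->.
- by move=> a s s' _ ->.
- by move=> s s' t t' _ -> _ ->.
- by move=> *; rewrite addrA.
- by move=> *; rewrite addrC.
- by move=> *; rewrite add0r.
- by move=> *; rewrite addNr.
- by move=> *; rewrite scalerA.
- by move=> *; rewrite scale1r.
- by move=> *; rewrite scalerDr.
- by move=> *; rewrite scalerDl.
- by move=> *; rewrite lieDl.
- by move=> *; rewrite lieZl.
- by move=> *; rewrite lieDr.
- by move=> *; rewrite lieZr.
- by move=> *; rewrite liexx.
- by move=> *; rewrite jacobi.
- by move=> *; rewrite linearD.
- by move=> *; rewrite linearZ.
Qed.

Definition flift (f : freeLie) : L := teval (repr f).

Let fliftE s : flift (fclass s) = teval s.
Proof. exact/teval_cong/repr_fclass. Qed.

Fact flift_linear : linear flift.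
Proof.
by move=> a f g; rewrite -[f]fclassK -[g]fclassK fZE fDE !fliftE.
Qed.
HB.instance Definition _ := GRing.isLinear.Build K freeLie L _ flift flift_linear.

Lemma flift_lie : lie_morphism flift.
Proof.
move=> f g /=; rewrite -[f]fclassK -[g]fclassK fLE.
by rewrite !fliftE.
Qed.

Lemma flift_gen u : flift (fgen u) = j u.
Proof. exact: fliftE. Qed.

Lemma flift_unique (h : {linear freeLie -> L}) :
  lie_morphism h -> (forall u, h (fgen u) = j u) -> h =1 flift.
Proof.
move=> hL hj; apply: freeLie_ind => [u||f g ef eg|a f ef|f g ef eg].
- by rewrite hj flift_gen.
- by rewrite !linear0.
- by rewrite !linearD ef eg.
- by rewrite !linearZ ef.
- by rewrite hL flift_lie ef eg.
Qed.

End Universal.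
End FreeLie.

(* Metabelian Lie algebras L with a linear map U -> L, which is what makes L' a
   module over Sym(U). *)
Record metabLie (K : fieldType) (U : lmodType K) := MetabLie {
  metab_alg :> lieAlgType K;
  metab_gen : {linear U -> metab_alg};
  metab_metab : metabelian metab_alg }.

Section Metabelian.
Variables (K : fieldType) (U : lmodType K).

Lemma quot_derived2 (L : lieAlgType K) (J : lieIdeal L) :
  derived2 L `<=` J -> metabelian (quotlie J).
Proof.
move=> sJ.
have der q : derived (quotlie J) q -> exists2 v, derived L v & lproj J v = q.
  elim=> {q} [_ [p [q [_ _ ->]]] || p q _ [u du <-] _ [v dv <-] | a q _ [u du <-]].
  - have [u <-] := lproj_surj p; have [v <-] := lproj_surj q.
    by exists (lie u v); [apply: derived_lie | rewrite lproj_lie].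
  - by exists 0; [apply: submod0 | rewrite linear0].
  - by exists (u + v); [apply: submodD | rewrite linearD].
  - by exists (a *: u); [apply: submodZ | rewrite linearZ].
move=> q; elim=> {q} [_ [p [q [/der[u du <-] /der[v dv <-] ->]]]
  || p q _ -> _ -> | a q _ ->].
- by rewrite -lproj_lie; apply/lproj_eq0/sJ/span_gen; exists u, v.
- by [].
- by rewrite addr0.
- by rewrite scaler0.
Qed.

Definition metab_quot (L : lieAlgType K) (g : {linear U -> L}) (J : lieIdeal L)
    (sJ : derived2 L `<=` J) : metabLie U :=
  MetabLie (GRing.Linear.clone _ _ _ _ (lproj J \o g) _) (quot_derived2 sJ).

(* M(U) = Lie(U) / Lie(U)''. *)
Definition freeMetab : metabLie U :=
  metab_quot (@fgen K U) (@subset_refl _ (derived2 (freeLie U))).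

Fact metab_sub (L : metabLie U) (J : lieIdeal L) : derived2 L `<=` J.
Proof. by move=> v /metab_metab ->; apply: submod0. Qed.

Definition quotMetab (L : metabLie U) (J : lieIdeal L) : metabLie U :=
  metab_quot (@metab_gen K U L) (@metab_sub L J).

Lemma freeMetab_ind (P : freeMetab -> Prop) :
  (forall u, P (metab_gen _ u)) -> P 0 -> (forall f g, P f -> P g -> P (f + g)) ->
  (forall a f, P f -> P (a *: f)) -> (forall f g, P f -> P g -> P (lie f g)) ->
  forall f, P f.
Proof.
move=> Pg P0 PD PZ PL f; have [v <-] := lproj_surj f.
elim/freeLie_ind: v => {f} [u||f g Pf Pgg|a f Pf|f g Pf Pgg].
- exact: Pg.
- by rewrite linear0.
- by rewrite linearD; apply: PD.
- by rewrite linearZ; apply: PZ.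
- by rewrite lproj_lie; apply: PL.
Qed.

Lemma derived_abelian (L : metabLie U) (u v : L) :
  derived L u -> derived L v -> lie u v = 0.
Proof. by move=> du dv; apply: (@metab_metab _ _ L); apply: span_gen; exists u, v. Qed.

(* The span of the n-fold brackets of elements of g(U): the component of Lie
   degree n when L is the free Lie algebra on U, and the image of that component
   when L is a quotient of it. *)
Inductive lie_degree (L : lieAlgType K) (g : U -> L) : nat -> L -> Prop :=
  | ldeg_gen u : lie_degree g 1 (g u)
  | ldeg_0 n : lie_degree g n 0
  | ldeg_D n u v : lie_degree g n u -> lie_degree g n v -> lie_degree g n (u + v)
  | ldeg_Z n a u : lie_degree g n u -> lie_degree g n (a *: u)
  | ldeg_lie m n u v :
      lie_degree g m u -> lie_degree g n v -> lie_degree g (m + n) (lie u v).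

End Metabelian.

Section PolyAct.
Variables (K : fieldType) (V : lmodType K) (n : nat).
Variable f : 'I_n -> {linear V -> V}.
Implicit Types (m : 'X_{1..n}) (p q : {mpoly K[n]}) (v w : V).

Definition mon_act m v : V :=
  foldr (fun i w => iter (m i) (f i) w) v (enum 'I_n).

Definition poly_act p v : V := \sum_(m <- msupp p) p@_m *: mon_act m v.

Lemma iter_linear i k : linear (iter k (f i)).
Proof. by elim: k => [|k IH] a u v //=; rewrite IH linearP. Qed.

Lemma mon_act_linear m : linear (mon_act m).
Proof.
rewrite /mon_act; elim: (enum _) => [|i s IH] a u v //=.
by rewrite IH iter_linear.
Qed.
HB.instance Definition _ m :=
  GRing.isLinear.Build K V V _ (mon_act m) (mon_act_linear m).

Lemma poly_act_linear p : linear (poly_act p).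
Proof.
move=> a u v; rewrite /poly_act scaler_sumr -big_split /=.
by apply: eq_bigr => m _; rewrite linearP scalerDr !scalerA mulrC.
Qed.
HB.instance Definition _ p :=
  GRing.isLinear.Build K V V _ (poly_act p) (poly_act_linear p).

Lemma poly_act_wide (s : seq 'X_{1..n}) p v :
  uniq s -> {subset msupp p <= s} ->
  poly_act p v = \sum_(m <- s) p@_m *: mon_act m v.
Proof.
move=> us sub; rewrite (bigID (fun m => m \in msupp p)) /= [X in _ + X]big1 ?addr0; last first.
  by move=> m; rewrite -mcoeff_eq0 => /eqP ->; rewrite scale0r.
rewrite -big_filter; apply: perm_big; apply: uniq_perm => [||m].
- exact: msupp_uniq.
- exact: filter_uniq.
- by rewrite mem_filter; case: (boolP (m \in msupp p)) => //= /sub ->.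
Qed.

Lemma poly_actD p q v : poly_act (p + q) v = poly_act p v + poly_act q v.
Proof.
pose s := undup (msupp p ++ msupp q); have us : uniq s by apply: undup_uniq.
rewrite !(@poly_act_wide s) //.
- by rewrite -big_split /=; apply: eq_bigr => m _; rewrite mcoeffD scalerDl.
- by move=> m mq; rewrite mem_undup mem_cat mq orbT.
- by move=> m mp; rewrite mem_undup mem_cat mp.
- by move=> m /msuppD_le; rewrite mem_undup.
Qed.

Lemma poly_actZ a p v : poly_act (a *: p) v = a *: poly_act p v.
Proof.
rewrite (@poly_act_wide (msupp p)) ?msupp_uniq //; last exact: msuppZ_le.
by rewrite scaler_sumr; apply: eq_bigr => m _; rewrite mcoeffZ scalerA.
Qed.

Lemma poly_act0 v : poly_act 0 v = 0.
Proof. by rewrite /poly_act msupp0 big_nil. Qed.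

Lemma poly_act_sum I (r : seq I) (F : I -> {mpoly K[n]}) v :
  poly_act (\sum_(i <- r) F i) v = \sum_(i <- r) poly_act (F i) v.
Proof.
elim: r => [|i r IH]; first by rewrite !big_nil poly_act0.
by rewrite !big_cons poly_actD IH.
Qed.

Lemma poly_actX m v : poly_act 'X_[m] v = mon_act m v.
Proof. by rewrite /poly_act msuppX big_seq1 mcoeffX eqxx scale1r. Qed.

Lemma mon_act0 v : mon_act 0%MM v = v.
Proof. by rewrite /mon_act; elim: (enum _) => //= i s ->; rewrite mnm0E. Qed.

Lemma poly_act1 v : poly_act 1 v = v.
Proof. by rewrite -mpolyX0 poly_actX mon_act0. Qed.

Lemma poly_actXi i v : poly_act 'X_i v = f i v.
Proof.
rewrite poly_actX /mon_act.
have: i \in enum 'I_n by rewrite mem_enum.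
have: uniq (enum 'I_n) by apply: enum_uniq.
have e0 (s : seq 'I_n) : i \notin s ->
    foldr (fun j w => iter (U_(i)%MM j) (f j) w) v s = v.
  elim: s => //= j s IH; rewrite inE negb_or mnm1E => /andP[/negPf-> /IH->] //.
elim: (enum _) => //= j s IH /andP[js us]; rewrite inE mnm1E.
have [eij _ | nij /= /(IH us) ->] := eqVneq i j; last by [].
by rewrite e0 eij //= -eij.
Qed.

Hypothesis fC : forall i j v, f i (f j v) = f j (f i v).

Lemma iterC i j k l v :
  iter k (f i) (iter l (f j) v) = iter l (f j) (iter k (f i) v).
Proof.
elim: k => //= k ->; elim: l => //= l IH.
by rewrite fC IH.
Qed.

Lemma mon_actM m1 m2 v : mon_act (m1 + m2)%MM v = mon_act m1 (mon_act m2 v).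
Proof.
rewrite /mon_act; elim: (enum _) => //= i s ->.
rewrite mnmDE iterD; congr iter; move: (foldr _ v s) => w.
by elim: s => //= j s <-; rewrite iterC.
Qed.

Lemma poly_actM p q v : poly_act (p * q) v = poly_act p (poly_act q v).
Proof.
rewrite mpolyME big_allpairs poly_act_sum [RHS]/poly_act.
apply: eq_bigr => m1 _; rewrite poly_act_sum linear_sum scaler_sumr.
apply: eq_bigr => m2 _ /=.
by rewrite poly_actZ poly_actX mon_actM linearZ scalerA.
Qed.

End PolyAct.

(* Sym(U), with the coordinates on the basis [vbasis fullv] of U as variables;
   U embeds in it by [sym_gen], and [sym_lift] is its universal property. *)
Notation Sym K U := {mpoly K[\dim (@fullv K U)]}.

Section SymAlg.
Variables (K : fieldType) (U : vectType K).

Definition Ubasis (i : 'I_(\dim (@fullv K U))) : U := (vbasis fullv)`_i.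

Definition sym_gen (u : U) : Sym K U :=
  \sum_i coord (vbasis fullv) i u *: 'X_i.

Fact sym_gen_linear : linear sym_gen.
Proof.
move=> a u v; rewrite /sym_gen scaler_sumr -big_split; apply: eq_bigr => i _ /=.
by rewrite linearP scalerDl scalerA.
Qed.
HB.instance Definition _ := GRing.isLinear.Build K U (Sym K U) _
  sym_gen sym_gen_linear.

Lemma Ubasis_coord u : u = \sum_i coord (vbasis fullv) i u *: Ubasis i.
Proof. by rewrite {1}(coord_vbasis (memvf u)). Qed.

Lemma sym_gen_basis i : sym_gen (Ubasis i) = 'X_i.
Proof.
rewrite /sym_gen /Ubasis (bigD1 i) //= big1 ?addr0 => [|j ji].
  by rewrite coord_free ?eqxx ?scale1r // (basis_free (vbasisP _)).
by rewrite coord_free ?(basis_free (vbasisP _)) // eq_sym (negPf ji) scale0r.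
Qed.

Lemma sym_lift (A : comAlgType K) (g : {linear U -> A}) :
  exists2 h : {lrmorphism Sym K U -> A}, (forall u, h (sym_gen u) = g u) &
  forall h' : {lrmorphism Sym K U -> A}, (forall u, h' (sym_gen u) = g u) -> h' =1 h.
Proof.
pose h := mmap (GRing.in_alg A) (g \o Ubasis).
have hZ : scalable h by move=> a p; rewrite /h mmapZ /= mulr_algl.
pose hL := GRing.isScalable.Build K (Sym K U) A *:%R h hZ.
pose h1 : {lrmorphism Sym K U -> A} := HB.pack h hL.
exists h1 => [u | h' h'g p].
  rewrite /sym_gen linear_sum {2}[u]Ubasis_coord linear_sum.
  apply: eq_bigr => i _; rewrite !linearZ; congr (_ *: _).
  by rewrite /= /h mmapX mmap1U.
rewrite [p]mpolyE !linear_sum; apply: eq_bigr => m _.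
rewrite !linearZ; congr (_ *: _); rewrite mpolyXE_id !rmorph_prod.
apply: eq_bigr => i _; rewrite !rmorphXn; congr (_ ^+ _).
have e : h' 'X_i = g (Ubasis i) by rewrite -sym_gen_basis h'g.
by apply: (etrans e); rewrite /= /h mmapX mmap1U.
Qed.

End SymAlg.

Section DerivedModule.
Variables (K : fieldType) (U : vectType K) (L : metabLie U).

Definition derived_pred : {pred L} := fun v => `[< derived L v >].

Fact derived_pred_closed : submod_closed derived_pred.
Proof.
split=> [|a u v /asboolP du /asboolP dv]; apply/asboolP; first exact: submod0.
by apply: submodD => //; apply: submodZ.
Qed.
HB.instance Definition _ := GRing.isSubmodClosed.Build K L derived_pred
  derived_pred_closed.

Record derK := DerK { derK_val : L; _ : derK_val \in derived_pred }.
HB.instance Definition _ := [isSub for derK_val].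
HB.instance Definition _ := [Choice of derK by <:].
HB.instance Definition _ := [SubChoice_isSubLmodule of derK by <:].

Lemma derK_valP (b : derK) : derived L (val b).
Proof. by case: b => v /= /asboolP. Qed.

Definition der_ad (u : L) (b : derK) : derK :=
  DerK (introT (asboolP _) (derived_lie u (val b))).

Fact der_ad_linear u : linear (der_ad u).
Proof. by move=> a b c; apply: val_inj; rewrite /= lieDr lieZr. Qed.
HB.instance Definition _ u :=
  GRing.isLinear.Build K derK derK _ (der_ad u) (der_ad_linear u).

Lemma der_adC u v b : der_ad u (der_ad v b) = der_ad v (der_ad u b).
Proof.
apply: val_inj => /=; rewrite jacobi_ad [X in X + _]derived_abelian ?add0r //.
  exact: derived_lie.
exact: derK_valP.
Qed.

(* The derived algebra of L, with its structure of module over Sym(U); the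
   structure of K-vector space is obtained by restriction of scalars. *)
Definition der : Type := derK.
HB.instance Definition _ := GRing.Zmodule.on der.

Definition der_val (b : der) : L := val (b : derK).

Definition der_gen (i : 'I_(\dim (@fullv K U))) : {linear derK -> derK} :=
  der_ad (metab_gen L (Ubasis i)).

Definition der_scale (p : Sym K U) (b : der) : der := poly_act der_gen p b.

Let der_genC i j b : der_gen i (der_gen j b) = der_gen j (der_gen i b).
Proof. exact: der_adC. Qed.

Fact der_scaleA p q b : der_scale p (der_scale q b) = der_scale (p * q) b.
Proof. by rewrite /der_scale poly_actM. Qed.
Fact der_scale1 : left_id 1 der_scale.
Proof. exact: poly_act1. Qed.
Fact der_scaleDr : right_distributive der_scale +%R.
Proof. by move=> p b c; apply: (linearD (poly_act der_gen p)). Qed.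
Fact der_scaleDl b : {morph der_scale^~ b : p q / p + q}.
Proof. by move=> p q; apply: poly_actD. Qed.

HB.instance Definition _ := GRing.Zmodule_isLmodule.Build (Sym K U) der
  der_scaleA der_scale1 der_scaleDr der_scaleDl.

Lemma der_valP (b : der) : derived L (der_val b).
Proof. exact: derK_valP. Qed.

Lemma der_val_inj : injective der_val.
Proof. exact: val_inj. Qed.

Lemma derP (v : L) : derived L v -> exists b : der, der_val b = v.
Proof. by move=> dv; exists (DerK (introT (asboolP _) dv)). Qed.

Lemma der_val0 : der_val 0 = 0.
Proof. exact: linear0. Qed.

Lemma der_valD (b c : der) : der_val (b + c) = der_val b + der_val c.
Proof. exact: linearD. Qed.

Lemma der_valZ (a : K) (b : der) : der_val (a%:MP *: b) = a *: der_val b.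
Proof.
rewrite /GRing.scale /= /der_scale -[_%:MP]mulr1 mul_mpolyC poly_actZ poly_act1.
exact: linearZ.
Qed.

(* The defining property u . b = [u, b] of the module structure. *)
Lemma der_symE (u : U) (b : der) :
  der_val (sym_gen u *: b) = lie (metab_gen L u) (der_val b).
Proof.
rewrite /GRing.scale /= /der_scale poly_act_sum {2}[u]Ubasis_coord linear_sum.
rewrite /der_val (linear_sum (\val : {linear derK -> L})) lie_suml.
apply: eq_bigr => i _; rewrite poly_actZ poly_actXi.
by rewrite linearZZ [in RHS]linearZZ lieZl.
Qed.

(* r is the internal degree: commutators of elements of U have degree 0. *)
Definition der_degree (r : nat) (b : der) : Prop :=
  lie_degree (metab_gen L) (r + 2) (der_val b).

End DerivedModule.

Arguments der {K U} L.

Section IdealQuotient.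
Variables (K : fieldType) (U : vectType K) (J : ideal (Sym K U)).

Definition JB : submod (der (freeMetab U)) := ideal_mul J (der (freeMetab U)).

Definition JB_set : set (freeMetab U) := [set v | exists2 b, JB b & der_val b = v].

Fact JB_set0 : JB_set 0.
Proof. by exists 0; [apply: submod0 | apply: der_val0]. Qed.

Fact JB_setD u v : JB_set u -> JB_set v -> JB_set (u + v).
Proof.
move=> [b Jb <-] [c Jc <-].
by exists (b + c); [apply: submodD | apply: der_valD].
Qed.

Fact JB_setZ a v : JB_set v -> JB_set (a *: v).
Proof.
move=> [b Jb <-].
by exists (a%:MP *: b); [apply: submodZ | apply: der_valZ].
Qed.

Fact JB_set_lie u v : JB_set v -> JB_set (lie u v).
Proof.
elim/freeMetab_ind: u v => [u||f g IHf IHg|a f IHf|f g _ _] v Jv.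
- have [b Jb <-] := Jv; exists (sym_gen u *: b); first exact: submodZ.
  exact: der_symE.
- by rewrite lie0r; apply: JB_set0.
- by rewrite lieDl; apply: JB_setD; [apply: IHf | apply: IHg].
- by rewrite lieZl; apply: JB_setZ; apply: IHf.
- have [b _ <-] := Jv; rewrite derived_abelian; first exact: JB_set0.
    exact: derived_lie.
  exact: der_valP.
Qed.

Definition JB_ideal : lieIdeal (freeMetab U) :=
  @LieIdeal _ _ (Submod JB_set0 JB_setD JB_setZ) JB_set_lie.

(* M(U) / JB(U), where B(U) is der (freeMetab U). *)
Definition metab_of_ideal : metabLie U := quotMetab JB_ideal.

Lemma JB_idealE (b : der (freeMetab U)) : JB_ideal (der_val b) <-> JB b.
Proof. by split=> [[c Jc /der_val_inj <-] // | Jb]; exists b. Qed.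

(* The component of internal degree r of B(U)/JB(U). *)
Definition quot_degree (r : nat) (q : quotmod JB) : Prop :=
  exists2 b, der_degree r b & qproj JB b = q.

End IdealQuotient.

(* Main.v *)
(* [B(U)] is generated over [Sym U] by [[y, z]], [[z, x]] and [[x, y]], subject to
   the Jacobi relation [x [y, z] + y [z, x] + z [x, y] = 0]. As [a >= 1], a factor
   [x] of [s = x^a y^b z^c] can be traded along this relation, so that
   [s [y, z] = - x^(a-1) y^(b+1) z^c [z, x] - x^(a-1) y^b z^(c+1) [x, y]] lies in
   [IB(U)], and symmetrically for the other two generators: hence
   [s B(U) <= IB(U)]. Any other monomial of degree [a + b + c] is already in [I],
   which settles the degree [d] component. Finally [s] is not in [I], since a
   monomial dividing [s] has coefficient 0 in every element of [I]. *)
Require Import Defs.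
From HB Require Import structures.
From mathcomp Require Import all_boot all_order all_algebra.
From mathcomp Require Import boolp classical_sets.
From mathcomp Require Import mpoly.

Set Implicit Arguments.
Unset Strict Implicit.
Unset Printing Implicit Defensive.

Import GRing.Theory.
Local Open Scope classical_set_scope.
Local Open Scope ring_scope.

(** * Products of ideals with modules *)

Lemma ideal_mul_gen (R : comNzRingType) (I : ideal R) (V : lmodType R) p v :
  I p -> ideal_mul I V (p *: v).
Proof. by move=> Ip; apply: span_gen; exists p => //; exists v. Qed.

(** For each fixed [w], the scalars sending [w] into $IV$ form an ideal; it contains $I$ and $s$,
    hence their sum. *)
Lemma ideal_mul_addsm (R : comNzRingType) (I : ideal R) (s : R) (V : lmodType R) :
  (forall v, ideal_mul I V (s *: v)) ->
  ideal_mul I V = ideal_mul (addsm I (genideal [set s])) V.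
Proof.
move=> Is; apply/submod_eqP/seteqP; split.
  apply: span_min => _ [p Ip [w ->]]; apply: ideal_mul_gen.
  by apply: span_gen; left.
apply: span_min => _ [p Jp [w ->]]; elim: Jp => {p} [p [Ip|Sp]||p q _ ? _ ?|p q _ ?].
- exact: ideal_mul_gen.
- elim: Sp => {p} [_ ->||p q _ ? _ ?|p q _ ?].
  + exact: Is.
  + by rewrite scale0r; apply: submod0.
  + by rewrite scalerDl; apply: submodD.
  + by rewrite -scalerA; apply: submodZ.
- by rewrite scale0r; apply: submod0.
- by rewrite scalerDl; apply: submodD.
- by rewrite -scalerA; apply: submodZ.
Qed.

(** * Monomial multiples of module elements *)

Section MonomialSubmodules.
Variables (R : comNzRingType) (V : lmodType R) (N : submod V) (X Y Z : R).

Lemma submodM p q v : N (p *: v) -> N ((q * p) *: v).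
Proof. by rewrite -scalerA; apply: submodZ. Qed.

(* One factor [X] of the monomial is traded for [Y] or [Z] along the relation. *)
Lemma syzygy_monomial a b c w1 w2 w3 :
  (0 < a)%N -> X *: w1 + Y *: w2 + Z *: w3 = 0 ->
  N (Y ^+ b.+1 *: w2) -> N (Z ^+ c.+1 *: w3) ->
  N ((X ^+ a * Y ^+ b * Z ^+ c) *: w1).
Proof.
case: a => // a _ rel Nw2 Nw3.
have -> : (X ^+ a.+1 * Y ^+ b * Z ^+ c) *: w1 =
    - ((X ^+ a * Z ^+ c * Y ^+ b.+1) *: w2 + (X ^+ a * Y ^+ b * Z ^+ c.+1) *: w3).
  apply/eqP; rewrite -addr_eq0 addrA; apply/eqP.
  rewrite -(scaler0 _ (X ^+ a * Y ^+ b * Z ^+ c)) -rel !scalerDr !scalerA.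
  congr (_ *: _ + _ *: _ + _ *: _).
  - by rewrite exprS -!mulrA mulrC -!mulrA.
  - by rewrite exprSr -!mulrA; congr (_ * _); rewrite mulrC -mulrA [Y * _]mulrC.
  - by rewrite exprSr mulrA.
by apply/submodN/submodD; apply: submodM.
Qed.

(** As [w] is arbitrary, the span of this set is $(X,Y,Z)^nV$. *)
Definition monomials n : set V :=
  [set v | exists i j k w,
     (i + j + k = n)%N /\ v = (X ^+ i * Y ^+ j * Z ^+ k) *: w].

(** Pigeonhole: exponents with sum $a+b+c$ either exceed [a], [b] or [c] in the corresponding place
    or are exactly [a], [b], [c]. *)
Lemma span_monomials_sub a b c :
  (forall w, N (X ^+ a.+1 *: w)) -> (forall w, N (Y ^+ b.+1 *: w)) ->
  (forall w, N (Z ^+ c.+1 *: w)) ->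
  (forall w, N ((X ^+ a * Y ^+ b * Z ^+ c) *: w)) ->
  Defs.span (monomials (a + b + c)%N) `<=` N.
Proof.
move=> NX NY NZ Ns; apply: span_min => _ [i [j [k [w [ijk ->]]]]].
have Nexp (T : R) e f : (forall w, N (T ^+ e.+1 *: w)) -> (e < f)%N ->
    forall w, N (T ^+ f *: w).
  by move=> NT ef u; rewrite -(subnK ef) exprD; apply: submodM.
have [ia|ai] := ltnP a i.
  by rewrite -mulrA mulrC; apply/submodM/Nexp/ia.
have [jb|bj] := ltnP b j.
  by rewrite mulrAC; apply/submodM/Nexp/jb.
have [kc|ck] := ltnP c k; first by apply/submodM/Nexp/kc.
suff [-> -> ->] : [/\ i = a, j = b & k = c] by [].
have le1 : (i + j <= a + b)%N by rewrite leq_add.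
(* Three inequalities whose sum is an equality are themselves equalities. *)
have := leqif_add (leqif_add (leqif_eq ai) (leqif_eq bj)) (leqif_eq ck).
by case=> _; rewrite ijk eqxx => /esym/andP[/andP[/eqP-> /eqP->] /eqP->].
Qed.

End MonomialSubmodules.

(** * Coefficients and images of elements of generated ideals *)

(** The coefficient of $pq$ at [k] involves only coefficients of [q] at divisors of [k], and these
    again divide [m]; so the vanishing condition defines an ideal. *)
Lemma genideal_sub_monomial (K : fieldType) n (m : 'X_{1..n})
    (S : set {mpoly K[n]}) p :
  (forall q, S q -> forall k : 'X_{1..n}, (k <= m)%MM -> q@_k = 0) ->
  genideal S p -> forall k : 'X_{1..n}, (k <= m)%MM -> p@_k = 0.
Proof.
move=> S0; elim=> {p} [q Sq|k _|p q _ IHp _ IHq k km|p q _ IHq k km].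
- exact: S0.
- by rewrite mcoeff0.
- by rewrite mcoeffD IHp ?IHq ?addr0.
- rewrite [_ *: _]/(p * q) mcoeffM big1 // => -[k1 k2] /= /eqP ek.
  rewrite [X in _ * X]IHq ?mulr0 //; apply: lepm_trans km.
  by have := lem_addl k1 k2; rewrite -ek.
Qed.

Lemma mcoeffXn_lt (K : fieldType) n (i : 'I_n) e (k : 'X_{1..n}) :
  (k i < e)%N -> ('X_i ^+ e : {mpoly K[n]})@_k = 0.
Proof.
move=> ke; rewrite mcoeffXn; case: eqP => // ek.
by move: ke; rewrite -ek mulmnE mnm1E eqxx mul1n ltnn.
Qed.

Lemma lrmorph_genideal (K : fieldType) (A B : comAlgType K)
    (h : {lrmorphism A -> B}) (S : set A) p :
  genideal S p -> genideal (h @` S) (h p).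
Proof.
elim=> {p} [q Sq||p q _ IHp _ IHq|p q _ IHq].
- by apply: span_gen; exists q.
- by rewrite rmorph0; apply: submod0.
- by rewrite rmorphD; apply: submodD.
- by rewrite [_ *: _]/(p * q) rmorphM; apply: (submodZ (s := genideal _) (h p)).
Qed.

(** * Generation of $B(U)$ by commutators of elements of $U$ *)

Section FreeMetabelian.
Variables (K : fieldType) (U : vectType K).
Local Notation M := (freeMetab U).
Local Notation B := (der M).
Local Notation g := (metab_gen M).

Definition commutators : set B := [set b | exists u v, der_val b = lie (g u) (g v)].
Local Notation G := (Defs.span commutators).

Let split (v : M) := exists u b, G b /\ v = g u + der_val b.

Let split_lie v w : split v -> split w -> exists2 b, G b & der_val b = lie v w.
Proof.
move=> [u [b [Gb ->]]] [u' [b' [Gb' ->]]].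
have [c ec] := derP (derived_lie (g u) (g u')).
(* Expansion of $[u+b,u'+b']$: here $[b,u']=(-u')\cdot b$, and $[b,b']=0$ in a metabelian
   algebra. *)
exists (c + sym_gen u *: b' + sym_gen (- u') *: b).
  apply: submodD; last exact: submodZ.
  apply: submodD; last exact: submodZ.
  by apply: span_gen; exists u, u'.
rewrite !der_valD !der_symE ec linearN lieNl -lieC lieDl !lieDr.
by rewrite [lie (der_val b) (der_val b')]derived_abelian ?addr0 //; apply: der_valP.
Qed.

(** The subspace $g(U)+G$ contains the Lie generators and is stable under brackets, so it is all of
    [M]; then every bracket lies in [G] by [split_lie]. *)
Lemma commutators_generate (b : B) : G b.
Proof.
have spl v : split v.
  elim/freeMetab_ind: v => [u||v w [u [p [Gp ->]]] [u' [p' [Gp' ->]]]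
    |a v [u [p [Gp ->]]]|v w /split_lie/[apply] -[p Gp <-]].
  - by exists u, 0; split; [apply: submod0 | rewrite der_val0 addr0].
  - by exists 0, 0; split; [apply: submod0 | rewrite der_val0 linear0 addr0].
  - exists (u + u'), (p + p'); split; first exact: submodD.
    by rewrite der_valD linearD addrACA.
  - exists (a *: u), (a%:MP *: p); split; first exact: submodZ.
    by rewrite der_valZ linearZ scalerDr.
  - by exists 0, p; rewrite linear0 add0r.
suff /(_ (der_valP b)) [c Gc /der_val_inj <-] : derived M (der_val b) ->
    exists2 c, G c & der_val c = der_val b by [].
elim=> {b} [_ [v [w [_ _ ->]]] || _ _ _ [p Gp <-] _ [q Gq <-] | a _ _ [p Gp <-]].
- exact: split_lie.
- by exists 0; [apply: submod0 | rewrite der_val0].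
- by exists (p + q); [apply: submodD | rewrite der_valD].
- by exists (a%:MP *: p); [apply: submodZ | rewrite der_valZ].
Qed.

End FreeMetabelian.

(** * Lifting along Lie quotients, and equality of quotients *)

Section LieQuotients.
Variables (K : fieldType) (U : vectType K).

Lemma lie_degree_lift (L : metabLie U) (J : lieIdeal L) n (v : quotMetab J) :
  lie_degree (metab_gen (quotMetab J)) n v ->
  exists2 w, lie_degree (metab_gen L) n w & lproj J w = v.
Proof.
elim=> {n v} [u|n|n _ _ _ [v dv <-] _ [w dw <-]|n k _ _ [v dv <-]
  |m n _ _ _ [v dv <-] _ [w dw <-]].
- by exists (metab_gen L u); [apply: ldeg_gen |].
- by exists 0; [apply: ldeg_0 | rewrite linear0].
- by exists (v + w); [apply: ldeg_D | rewrite linearD].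
- by exists (k *: v); [apply: ldeg_Z | rewrite linearZ].
- by exists (lie v w); [apply: ldeg_lie | rewrite lproj_lie].
Qed.

Lemma derived_lift (L : metabLie U) (J : lieIdeal L) (v : quotMetab J) :
  derived (quotMetab J) v -> exists2 w, derived L w & lproj J w = v.
Proof.
elim=> {v} [_ [p [q [_ _ ->]]] || _ _ _ [u du <-] _ [v dv <-] | a _ _ [u du <-]].
- have [u <-] := lproj_surj p; have [v <-] := lproj_surj q.
  by exists (lie u v); [apply: derived_lie | rewrite lproj_lie].
- by exists 0; [apply: submod0 | rewrite linear0].
- by exists (u + v); [apply: submodD | rewrite linearD].
- by exists (a *: u); [apply: submodZ | rewrite linearZ].
Qed.

(** A variable acts as the bracket with a generator, which [lproj J] preserves; monomials and linear
    combinations follow. This carries $sB(U)\subseteq IB(U)$ over to $s\,\mathfrak g_I'=0$. *)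
Lemma der_scale_lproj (L : metabLie U) (J : lieIdeal L) p
    (b : der L) (q : der (quotMetab J)) :
  der_val q = lproj J (der_val b) ->
  der_val (p *: q) = lproj J (der_val (p *: b)).
Proof.
have scaleE k (L' : metabLie U) (e : der L') (p' : Sym K U) :
    der_val ((k *: p') *: e) = k *: der_val (p' *: e).
  by rewrite -mul_mpolyC -scalerA der_valZ.
elim/mpolyind: p b q => [|k m p _ _ IHp] b q e.
  by rewrite !scale0r !der_val0 linear0.
rewrite !scalerDl !der_valD linearD (IHp _ _ e); congr (_ + _).
rewrite !scaleE linearZ /=; congr (_ *: _).
rewrite mpolyXE_id; elim/big_rec: _ => [|i p' _ IH]; first by rewrite !scale1r.
rewrite -!scalerA -sym_gen_basis.
elim: (m i) => [|n IHn]; first by rewrite !expr0 !scale1r.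
by rewrite exprS -!scalerA !der_symE IHn; apply/esym/lproj_lie.
Qed.

(** Equal ideals give literally the same quotient type, so the identity serves as the
    isomorphism. *)
Lemma quotlie_iso (L : lieAlgType K) (J1 J2 : lieIdeal L) : J1 = J2 ->
  exists f : {linear quotlie J1 -> quotlie J2},
    [/\ lie_morphism f, bijective f & forall m, f (lproj J1 m) = lproj J2 m].
Proof.
move=> <-; exists idfun; split=> //.
by exists idfun.
Qed.

Lemma lieIdeal_eqP (L : lieAlgType K) (J1 J2 : lieIdeal L) :
  (J1 : set L) = J2 -> J1 = J2.
Proof.
case: J1 J2 => [N1 l1] [N2 l2] /= /submod_eqP eN.
by case: N2 / eN l2 => l2; congr LieIdeal; apply: Prop_irrelevance.
Qed.

Lemma JB_ideal_eq (I J : ideal (Sym K U)) : JB I = JB J -> JB_ideal I = JB_ideal J.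
Proof. by move=> e; apply: lieIdeal_eqP; rewrite /= /JB_set e. Qed.

End LieQuotients.

(** * Degrees and the socle monomial over a basis of three elements *)

Section Rank3.
Variables (K : fieldType) (U : vectType K) (x y z : U).
Hypothesis xyz_basis : basis_of fullv [:: x; y; z].
Local Notation M := (freeMetab U).
Local Notation B := (der M).
Local Notation g := (metab_gen M).
Local Notation X := (sym_gen x).
Local Notation Y := (sym_gen y).
Local Notation Z := (sym_gen z).

Definition xyz_coord (u : U) (i : 'I_3) : K := coord [tuple x; y; z] i u.

Lemma xyz_coordE u :
  u = xyz_coord u 0 *: x + xyz_coord u 1 *: y + xyz_coord u 2 *: z.
Proof.
rewrite {1}(coord_basis (X := [tuple x; y; z]) xyz_basis (memvf u)).
by rewrite !big_ord_recl big_ord0 addr0 addrA /=; congr (_ *: _ + _ *: _ + _ *: _);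
  apply: congr2 => //; apply: val_inj.
Qed.

(** Bracketing an element of $L'$ with one of [U] multiplies it by a linear form in [X], [Y], [Z],
    while two elements of $L'$ commute; so each Lie degree beyond 2 contributes one such factor. *)
Lemma lie_degree_monomials (L : metabLie U) n (v : L) :
  lie_degree (metab_gen L) n.+2 v ->
  exists2 b, Defs.span (@monomials _ (der L) X Y Z n) b & der_val b = v.
Proof.
pose D := Defs.span (@monomials _ (der L) X Y Z _); pose g := metab_gen L.
have D0 b : D 0%N b.
  apply: span_gen; exists 0%N, 0%N, 0%N, b.
  by rewrite !expr0 !mulr1 scale1r.
have DS m u b : D m b -> D m.+1 (sym_gen u *: b).
  elim=> {b} [_ [i [j [k [w [ijk ->]]]]]||b c _ ? _ ?|p b _ ?].
  - have DX (t q : Sym K U) (k0 : K) :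
        D m.+1 ((t * q) *: w) -> D m.+1 ((k0 *: t * q) *: w).
      by rewrite -mul_mpolyC -mulrA; apply: submodM.
    rewrite scalerA [u]xyz_coordE 2!linearD !linearZ /= !mulrDl !scalerDl.
    apply: span_D; first apply: span_D; apply: DX; apply: span_gen.
    + by exists i.+1, j, k, w; rewrite exprS !addSn ijk !mulrA.
    + exists i, j.+1, k, w; rewrite exprS addnS addSn ijk; split=> //.
      by rewrite [X ^+ i * (Y * _)]mulrCA -[in RHS]mulrA.
    + exists i, j, k.+1, w; rewrite exprS addnS ijk; split=> //.
      by rewrite mulrCA.
  - by rewrite scaler0; apply: submod0.
  - by rewrite scalerDr; apply: submodD.
  - by rewrite scalerA mulrC -scalerA; apply: submodZ.
(* The induction has to cover the low degrees too: degree 0 holds only zero, degree 1 is the image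
   of [U], and internal degree starts at Lie degree 2. *)
pose P n v := match n with
  | 0 => v = 0
  | 1 => exists u, v = g u
  | n.+2 => exists2 b, D n b & der_val b = v end.
suff H m w : lie_degree g m w -> P m w by move/H.
elim=> {m w} [u|[|[|m]]|[|[|m]] v1 v2 _ + _|[|[|m]] k v1 _|m1 m2 v1 v2 _ + _] /=.
- by exists u.
- by [].
- by exists 0; rewrite linear0.
- by exists 0; [apply: span_0 | rewrite der_val0].
- by move=> -> ->; rewrite addr0.
- by move=> [u1 ->] [u2 ->]; exists (u1 + u2); rewrite linearD.
- move=> [b1 D1 <-] [b2 D2 <-].
  by exists (b1 + b2); [apply: span_D | rewrite der_valD].
- by move=> ->; rewrite scaler0.
- by move=> [u1 ->]; exists (k *: u1); rewrite linearZ.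
- move=> [b1 D1 <-].
  by exists (k%:MP *: b1); [apply: span_Z | rewrite der_valZ].
case: m1 m2 => [|[|m1]] [|[|m2]] /=.
- by move=> -> _; rewrite lie0r.
- by move=> -> _; rewrite lie0r; exists 0; rewrite linear0.
- by move=> -> _; rewrite lie0r; exists 0; [apply: span_0 | rewrite der_val0].
- by move=> _ ->; rewrite lie0; exists 0; rewrite linear0.
- move=> [u1 ->] [u2 ->]; have [b eb] := derP (derived_lie (g u1) (g u2)).
  by exists b => //; apply: D0.
- move=> [u1 ->] [b2 D2 <-]; exists (sym_gen u1 *: b2); first exact: DS.
  by rewrite der_symE.
- by move=> _ ->; rewrite lie0 addn0; exists 0; [apply: span_0 | rewrite der_val0].
- move=> [b1 D1 <-] [u2 ->]; exists (sym_gen (- u2) *: b1).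
    by rewrite addn1; apply: DS.
  by rewrite der_symE linearN lieNl -lieC.
- move=> [b1 _ <-] [b2 _ <-]; rewrite derived_abelian; try exact: der_valP.
  by exists 0; [apply: span_0 | rewrite der_val0].
Qed.

(** The bracket is bilinear and alternating, so closure under [K]-linear combinations is enough. *)
Lemma submod_xyz (S : submod M) :
  S (lie (g x) (g y)) -> S (lie (g y) (g z)) -> S (lie (g z) (g x)) ->
  forall u v, S (lie (g u) (g v)).
Proof.
move=> Sxy Syz Szx u v; rewrite [u]xyz_coordE [v]xyz_coordE.
have Sop p q : S (lie p q) -> S (lie q p) by rewrite lieC => /submodN; rewrite opprK.
have S0 p : S (lie p p) by rewrite liexx; apply: submod0.
by rewrite !linearD !linearZ /= !(lieDl, lieDr, lieZl, lieZr);
  do ?[apply: submodD | apply: submodZ]; auto.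
Qed.

Lemma socle_monomial_kills (N : submod B) a b c :
  (0 < a)%N -> (0 < b)%N -> (0 < c)%N ->
  (forall w, N (X ^+ a.+1 *: w)) -> (forall w, N (Y ^+ b.+1 *: w)) ->
  (forall w, N (Z ^+ c.+1 *: w)) ->
  forall w, N ((X ^+ a * Y ^+ b * Z ^+ c) *: w).
Proof.
move=> a0 b0 c0 NX NY NZ w.
set s := X ^+ a * Y ^+ b * Z ^+ c.
have [wx ex] := derP (derived_lie (g y) (g z)).
have [wy ey] := derP (derived_lie (g z) (g x)).
have [wz ez] := derP (derived_lie (g x) (g y)).
have rel : X *: wx + Y *: wy + Z *: wz = 0.
  by apply: der_val_inj; rewrite !der_valD !der_symE ex ey ez der_val0 jacobi.
(* The elements that [s] sends into [N], viewed inside [M] so that [submod_xyz] reduces the claim to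
   three brackets. *)
pose S := [set v : M | exists2 p, N (s *: p) & der_val p = v].
have S0 : S 0 by exists 0; [rewrite scaler0; apply: submod0 | apply: der_val0].
have SD u v : S u -> S v -> S (u + v).
  move=> [p Np <-] [q Nq <-]; exists (p + q); last exact: der_valD.
  by rewrite scalerDr; apply: submodD.
have SZ k v : S v -> S (k *: v).
  move=> [p Np <-]; exists (k%:MP *: p); last exact: der_valZ.
  by rewrite scalerA mulrC -scalerA; apply: submodZ.
elim: (commutators_generate w) => {w} [w [u [v ew]]||p q _ ? _ ?|p q _ ?].
- suff [p Np] : S (lie (g u) (g v)) by rewrite -ew => /der_val_inj <-.
  apply: (@submod_xyz (Submod S0 SD SZ)).
  (* The Jacobi relation and the factors of [s] are rotated cyclically, so that [Z] is the variable
     traded. *)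
  + exists wz => //; rewrite /s mulrC mulrA.
    by apply: (syzygy_monomial c0 _ (NX wx) (NY wy)); rewrite -addrA addrC.
  + by exists wx => //; apply: (syzygy_monomial a0 rel).
  + exists wy => //; rewrite /s -mulrA mulrC.
    by apply: (syzygy_monomial b0 _ (NZ wz) (NX wx)); rewrite addrC addrA.
- by rewrite scaler0; apply: submod0.
- by rewrite scalerDr; apply: submodD.
- by rewrite scalerA mulrC -scalerA; apply: submodZ.
Qed.

(** * Non-membership of $s$ in $I$ *)

Definition xyz_var (u : U) : {mpoly K[3]} := \sum_i xyz_coord u i *: 'X_i.

Fact xyz_var_linear : linear xyz_var.
Proof.
move=> k u v; rewrite /xyz_var scaler_sumr -big_split; apply: eq_bigr => i _ /=.
by rewrite /xyz_coord linearP scalerDl scalerA.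
Qed.
HB.instance Definition _ :=
  GRing.isLinear.Build K U {mpoly K[3]} _ xyz_var xyz_var_linear.

(* [Sym K U] has the coordinates on [vbasis fullv] as variables, so an lrmorphism
   is needed to make [X], [Y] and [Z] variables. *)
Lemma sym_xyz_vars : exists h : {lrmorphism Sym K U -> {mpoly K[3]}},
  [/\ h X = 'X_0, h Y = 'X_1 & h Z = 'X_2].
Proof.
have [h hE _] := sym_lift xyz_var.
have varE (i : 'I_3) : xyz_var [:: x; y; z]`_i = 'X_i.
  rewrite /xyz_var (bigD1 i) //= big1 ?addr0 => [|j ji].
    by rewrite /xyz_coord coord_free ?eqxx ?scale1r // (basis_free xyz_basis).
  rewrite /xyz_coord coord_free ?(basis_free xyz_basis) //.
  by rewrite eq_sym (negPf ji) scale0r.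
by exists h; rewrite !hE -(varE 0) -(varE 1) -(varE 2).
Qed.

Lemma socle_monomial_notin a b c :
  ~ genideal [set X ^+ a.+1; Y ^+ b.+1; Z ^+ c.+1] (X ^+ a * Y ^+ b * Z ^+ c).
Proof.
have [h [hX hY hZ]] := sym_xyz_vars.
move/(lrmorph_genideal h); rewrite !rmorphM !rmorphXn /= hX hY hZ !mpolyXn -!mpolyXD.
set m := (X in 'X_[X]).
move/(@genideal_sub_monomial _ _ m) => /(_ _ m (lepm_refl m)).
rewrite mcoeffX eqxx => m0; apply: (elimN eqP (oner_neq0 K)); apply: m0.
(* Each generator is a power of one variable, with exponent one more than in [m]; so no $k\le m$ is
   its exponent. *)
move=> _ [_ [[->|->]|->] <-] k /mnm_lepP km; rewrite rmorphXn /= ?hX ?hY ?hZ.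
all: apply: mcoeffXn_lt; rewrite ltnS (leq_trans (km _)) // /m !mnmDE !mulmnE !mnm1E /=.
all: by rewrite ?eqxx ?mul1n ?mul0n ?addn0 ?add0n.
Qed.

End Rank3.

Theorem theorem5p2 (K : fieldType) (charK : [pchar K] =i pred0)
    (U : vectType K) (x y z : U) (xyz_basis : basis_of fullv [:: x; y; z])
    (a b c : nat) (a_ge1 : (1 <= a)%N) (b_ge1 : (1 <= b)%N) (c_ge1 : (1 <= c)%N) :
  let X : Sym K U := sym_gen x in
  let Y : Sym K U := sym_gen y in
  let Z : Sym K U := sym_gen z in
  let I : ideal (Sym K U) :=
    genideal [set X ^+ a.+1; Y ^+ b.+1; Z ^+ c.+1] in
  let s : Sym K U := X ^+ a * Y ^+ b * Z ^+ c in
  let d : nat := (a + b + c)%N in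
  let Is : ideal (Sym K U) := addsm I (genideal [set s]) in
  let gI : metabLie U := metab_of_ideal I in
  let gIs : metabLie U := metab_of_ideal Is in
  [/\ forall q : quotmod (JB I), quot_degree d q -> q = 0,
      forall v : gI, derived gI v -> lie_degree (metab_gen gI) (d + 2) v -> v = 0,
      forall v : der gI, s *: v = 0,
      JB I = JB Is
    & ~ (forall p : Sym K U, I p <-> Is p) /\
      exists f : {linear gI -> gIs},
        [/\ lie_morphism f, bijective f &
            forall m : freeMetab U, f (lproj (JB_ideal I) m) = lproj (JB_ideal Is) m]].
Proof.
move=> X Y Z I s d Is gI gIs.
have IX w : JB I (X ^+ a.+1 *: w).
  by apply: ideal_mul_gen; apply: span_gen; left; left.
have IY w : JB I (Y ^+ b.+1 *: w).
  by apply: ideal_mul_gen; apply: span_gen; left; right.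
have IZ w : JB I (Z ^+ c.+1 *: w).
  by apply: ideal_mul_gen; apply: span_gen; right.
have Isoc := socle_monomial_kills xyz_basis a_ge1 b_ge1 c_ge1 IX IY IZ.
(* Both vanishing claims in degree [d] reduce to this inclusion in $M(U)$, as graded elements of the
   quotients lift to it. *)
have Ideg v : lie_degree (metab_gen (freeMetab U)) (d + 2) v ->
    exists2 e, JB I e & der_val e = v.
  rewrite addn2 => /(lie_degree_monomials xyz_basis) [e De <-].
  by exists e => //; apply: span_monomials_sub De.
have eJB : JB I = JB Is by apply: ideal_mul_addsm.
split=> //.
- move=> _ [e /Ideg [e' Ie' /der_val_inj ee] <-].
  by apply/qproj_eq0; rewrite -ee.
- move=> _ _ /lie_degree_lift [_ /Ideg [e Ie <-] <-].
  by apply/lproj_eq0/JB_idealE.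
- move=> v; have [_ /derP [e <-] ev] := derived_lift (der_valP v).
  apply: der_val_inj; rewrite (der_scale_lproj s (esym ev)) der_val0.
  by apply/lproj_eq0/JB_idealE/Isoc.
split; last exact: (quotlie_iso (JB_ideal_eq eJB)).
(* The two ideals are separated by [s] itself. *)
move=> /(_ s) [_ IsI]; apply: (socle_monomial_notin xyz_basis (a := a) (b := b) (c := c)).
by apply: IsI; apply: span_gen; right; apply: span_gen.
Qed.
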